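(* Let $\mathscr{A}$ be an abelian category, $\mathscr{C}$ a full subcategory of $\mathscr{A}$, $n\geq 1$ an integer, and $$0\to Y\to Y^0\to Y^1\to 0 \qquad (E)$$ an exact sequence in $\mathscr{A}$. Let $$0\to Y^0\to C_0^0\to C_1^0\to\cdots\to C_n^0 \qquad (R_0)$$ be a $\operatorname{Hom}_{\mathscr{A}}(-,\mathscr{C})$-exact exact sequence in $\mathscr{A}$ (its terms $C_i^0$ being objects of $\mathscr{A}$) and $$0\to Y^1\to C_0^1\to C_1^1\to\cdots\to C_{n-1}^1 \qquad (R_1)$$ a $\mathscr{C}$-coresolution of $Y^1$ in $\mathscr{A}$. Then: (1) There exists an exact sequence $$0\to Y\to C_0^0\to C_0^1\oplus C_1^0\to C_1^1\oplus C_2^0\to\cdots\to C_{n-1}^1\oplus C_n^0, \qquad (R)$$ which can be chosen so that, in addition, (2)–(5) hold: (2) If $(E)$, $(R_0)$ and $(R_1)$ are all $\operatorname{Hom}_{\mathscr{A}}(\mathscr{C},-)$-exact, then so is $(R)$. Moreover, if $\mathscr{C}$ is closed under finite direct sums, then: (3) If $(R_0)$ is a $\mathscr{C}$-coresolution of $Y^0$, then $(R)$ is a $\mathscr{C}$-coresolution of $Y$. (4) If $(E)$ is $\operatorname{Hom}_{\mathscr{A}}(-,\mathscr{C})$-exact and $(R_0)$ and $(R_1)$ are coproper $\mathscr{C}$-coresolutions of $Y^0$ and $Y^1$ respectively, then $(R)$ is a coproper $\mathscr{C}$-coresolution of $Y$. (5) If $(E)$ is strongly $\operatorname{Hom}_{\mathscr{A}}(-,\mathscr{C})$-exact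 and $(R_0)$ and $(R_1)$ are strongly coproper $\mathscr{C}$-coresolutions of $Y^0$ and $Y^1$ respectively, then $(R)$ is a strongly coproper $\mathscr{C}$-coresolution of $Y$.
   Context: All subcategories are full subcategories closed under isomorphisms. An exact sequence in $\mathscr{A}$ is called $\operatorname{Hom}_{\mathscr{A}}(\mathscr{C},-)$-exact (resp. $\operatorname{Hom}_{\mathscr{A}}(-,\mathscr{C})$-exact) if it remains exact after applying $\operatorname{Hom}_{\mathscr{A}}(D,-)$ (resp. $\operatorname{Hom}_{\mathscr{A}}(-,D)$) for every object $D$ of $\mathscr{C}$. Sequences here may be truncated on the right; no exactness is required at the rightmost term (before or after applying Hom functors) when it is not $0$. An exact sequence $0\to M\to Z^0\to Z^1\to\cdots\to Z^i\to\cdots$ (possibly truncated on the right) is strongly $\operatorname{Hom}_{\mathscr{A}}(-,\mathscr{C})$-exact if $\operatorname{Ext}_{\mathscr{A}}^1(K^i,D)=0$ for all $D$ in $\mathscr{C}$ and all $i\geq 1$ for which $Z^i$ occurs, where $K^i=\operatorname{Im}(Z^{i-1}\to Z^i)$; for the sequence $(E)$ this means $\operatorname{Ext}_{\mathscr{A}}^1(Y^1,D)=0$ for all $D$ in $\mathscr{C}$. A $\mathscr{C}$-coresolution of $M$ is an exact (possibly truncated on the right) sequence $0\to M\to Z^0\to Z^1\to\cdots\to Z^i\to\cdots$ in $\mathscr{A}$ with all $Z^i$ in $\mathscr{C}$; it is coproper if it is $\operatorname{Hom}_{\mathscr{A}}(-,\mathscr{C})$-exact and strongly coproper if it is strongly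 $\operatorname{Hom}_{\mathscr{A}}(-,\mathscr{C})$-exact. *)

(* Defs.v *)
From mathcomp Require Import all_boot all_order all_algebra.

Set Implicit Arguments.
Unset Strict Implicit.
Unset Printing Implicit Defensive.

Import GRing.Theory.
Local Open Scope ring_scope.

Record preadditive := Preadditive {
  obj :> Type;
  mor : obj -> obj -> zmodType;
  idmor : forall X : obj, mor X X;
  compm : forall X Y Z : obj, mor Y Z -> mor X Y -> mor X Z;
  compmA : forall (W X Y Z : obj) (h : mor Y Z) (g : mor X Y) (f : mor W X),
    compm h (compm g f) = compm (compm h g) f;
  comp1m : forall (X Y : obj) (f : mor X Y), compm (idmor Y) f = f;
  compm1 : forall (X Y : obj) (f : mor X Y), compm f (idmor X) = f;
  compmDl : forall (X Y Z : obj) (g g' : mor Y Z) (f : mor X Y),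
    compm (g + g') f = compm g f + compm g' f;
  compmDr : forall (X Y Z : obj) (g : mor Y Z) (f f' : mor X Y),
    compm g (f + f') = compm g f + compm g f'
}.

Section Preadditive.
Variable A : preadditive.
Implicit Types X Y Z T : A.

Definition monomorphism X Y (f : mor X Y) :=
  forall T (u v : mor T X), compm f u = compm f v -> u = v.

Definition epimorphism X Y (f : mor X Y) :=
  forall T (u v : mor Y T), compm u f = compm v f -> u = v.

Definition isomorphic X Y :=
  exists (f : mor X Y) (g : mor Y X),
    compm g f = idmor X /\ compm f g = idmor Y.

Definition is_zero Z :=
  (forall X (f : mor X Z), f = 0) /\ (forall X (f : mor Z X), f = 0).

Definition is_kernel K X Y (f : mor X Y) (k : mor K X) :=
  compm f k = 0 /\
  forall T (h : mor T X), compm f h = 0 -> exists! u : mor T K, compm k u = h.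

Definition is_cokernel X Y C (f : mor X Y) (c : mor Y C) :=
  compm c f = 0 /\
  forall T (h : mor Y T), compm h f = 0 -> exists! u : mor C T, compm u c = h.

Definition is_biproduct X Y S
    (i1 : mor X S) (i2 : mor Y S) (p1 : mor S X) (p2 : mor S Y) :=
  [/\ compm p1 i1 = idmor X, compm p2 i2 = idmor Y,
      compm p2 i1 = 0, compm p1 i2 = 0
    & compm i1 p1 + compm i2 p2 = idmor S].

Definition is_direct_sum n (X : 'I_n -> A) S :=
  exists (inj : forall k, mor (X k) S) (proj : forall k, mor S (X k)),
    [/\ forall k, compm (proj k) (inj k) = idmor (X k),
        forall j k, j != k -> compm (proj j) (inj k) = 0
      & \sum_(k < n) compm (inj k) (proj k) = idmor S].

End Preadditive.

Record abelian := Abelian {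
  ab_preadditive :> preadditive;
  zob : ab_preadditive;
  zobP : is_zero zob;
  biprod : ab_preadditive -> ab_preadditive -> ab_preadditive;
  injl : forall X Y, mor X (biprod X Y);
  injr : forall X Y, mor Y (biprod X Y);
  projl : forall X Y, mor (biprod X Y) X;
  projr : forall X Y, mor (biprod X Y) Y;
  biprodP : forall X Y,
    is_biproduct (injl X Y) (injr X Y) (projl X Y) (projr X Y);
  kernel : forall X Y : ab_preadditive, mor X Y -> ab_preadditive;
  kernel_mor : forall (X Y : ab_preadditive) (f : mor X Y), mor (kernel f) X;
  kernelP : forall (X Y : ab_preadditive) (f : mor X Y),
    is_kernel f (kernel_mor f);
  cokernel : forall X Y : ab_preadditive, mor X Y -> ab_preadditive;
  cokernel_mor : forall (X Y : ab_preadditive) (f : mor X Y),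
    mor Y (cokernel f);
  cokernelP : forall (X Y : ab_preadditive) (f : mor X Y),
    is_cokernel f (cokernel_mor f);
  mono_is_kernel : forall (X Y : ab_preadditive) (f : mor X Y),
    monomorphism f -> exists (Z : ab_preadditive) (g : mor Y Z), is_kernel g f;
  epi_is_cokernel : forall (X Y : ab_preadditive) (f : mor X Y),
    epimorphism f -> exists (W : ab_preadditive) (g : mor W X), is_cokernel g f
}.

Section Abelian.
Variable A : abelian.
Implicit Types X Y Z D M : A.

Definition im_obj X Y (f : mor X Y) : A := kernel (cokernel_mor f).
Definition im_mor X Y (f : mor X Y) : mor (im_obj f) Y :=
  kernel_mor (cokernel_mor f).

(* A condition saying that X -> Y -> Z is exact at Y, in A itself or after
   applying a Hom functor. *)
Definition exactness_notion :=
  forall X Y Z : A, mor X Y -> mor Y Z -> Prop.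

(* Im f = Ker g as subobjects of Y; in particular compm g f = 0. *)
Definition exact_at : exactness_notion := fun X Y Z f g =>
  is_kernel g (im_mor f).

Definition exact_ab (U V W : zmodType) (f : U -> V) (g : V -> W) :=
  forall v : V, g v = 0 <-> exists u : U, f u = v.

Definition hom_covar D X Y (f : mor X Y) : mor D X -> mor D Y :=
  fun u => compm f u.

Definition hom_contra D X Y (f : mor X Y) : mor Y D -> mor X D :=
  fun u => compm u f.

Definition exact_hom_from D : exactness_notion := fun X Y Z f g =>
  exact_ab (@hom_covar D X Y f) (@hom_covar D Y Z g).

Definition exact_hom_into D : exactness_notion := fun X Y Z f g =>
  exact_ab (@hom_contra D Y Z g) (@hom_contra D X Y f).

(* 0 -> X -> Y -> Z -> 0 *)
Definition short_seq (ex : exactness_notion) X Y Z (f : mor X Y) (g : mor Y Z) :=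
  [/\ ex _ _ _ (0 : mor (zob A) X) f, ex _ _ _ f g
    & ex _ _ _ g (0 : mor Z (zob A))].

(* Vanishing of the Yoneda Ext^1(K, D): every extension of K by D is equivalent
   to the split one, i.e. has a morphism to it which is the identity on D and
   on K (such a morphism is an isomorphism by the five lemma). *)
Definition Ext1_eq0 (K D : A) :=
  forall (E : A) (a : mor D E) (b : mor E K), short_seq exact_at a b ->
  exists phi : mor E (biprod D K),
    compm phi a = injl D K /\ compm (projr D K) phi = b.

(* M -> Z 0 -> Z 1 -> ...  A sequence 0 -> M -> Z 0 -> ... -> Z m truncated at
   Z m is a [coseq M Z] of which the objects Z i with m < i and the morphisms
   out of Z i with m <= i are never looked at. *)
Record coseq M (Z : nat -> A) := Coseq {
  caug : mor M (Z 0%N);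
  cdiff : forall i, mor (Z i) (Z i.+1)
}.

(* Exactness of 0 -> M -> Z 0 -> ... -> Z m everywhere except at Z m. *)
Definition coseq_exact (ex : exactness_notion) (m : nat) M (Z : nat -> A)
    (S : coseq M Z) :=
  [/\ ex _ _ _ (0 : mor (zob A) M) (caug S),
      (0 < m)%N -> ex _ _ _ (caug S) (cdiff S 0)
    & forall i, (i.+1 < m)%N -> ex _ _ _ (cdiff S i) (cdiff S i.+1)].

(* Full subcategories are given by their objects. *)
Variable C : A -> Prop.

Definition iso_closed := forall X Y, isomorphic X Y -> C X -> C Y.

(* Only sums of nonempty families: the zero object need not lie in C. *)
Definition finite_sum_closed :=
  forall n (X : 'I_n.+1 -> A) (S : A),
    (forall k, C (X k)) -> is_direct_sum X S -> C S.

Definition short_exact_from X Y Z (f : mor X Y) (g : mor Y Z) :=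
  forall D, C D -> short_seq (exact_hom_from D) f g.

Definition short_exact_into X Y Z (f : mor X Y) (g : mor Y Z) :=
  forall D, C D -> short_seq (exact_hom_into D) f g.

Definition short_exact_strongly_into X Y Z (f : mor X Y) (g : mor Y Z) :=
  short_seq exact_at f g /\ forall D, C D -> Ext1_eq0 Z D.

Section Truncated.
Variables (m : nat) (M : A) (Z : nat -> A) (S : coseq M Z).

Definition coseq_exact_from :=
  forall D, C D -> coseq_exact (exact_hom_from D) m S.

Definition coseq_exact_into :=
  forall D, C D -> coseq_exact (exact_hom_into D) m S.

(* K^(i+1) = Im (Z i -> Z (i+1)), for i+1 <= m. *)
Definition coseq_strongly_into :=
  coseq_exact exact_at m S /\
  forall D, C D -> forall i, (i < m)%N -> Ext1_eq0 (im_obj (cdiff S i)) D.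

Definition coresolution :=
  coseq_exact exact_at m S /\ forall i, (i <= m)%N -> C (Z i).

Definition coproper_coresolution := coresolution /\ coseq_exact_into.

Definition strongly_coproper_coresolution :=
  coresolution /\ coseq_strongly_into.

End Truncated.

(* C0 0, C1 0 (+) C0 1, C1 1 (+) C0 2, ... *)
Definition cone_terms (C0 C1 : nat -> A) (i : nat) : A :=
  if i is j.+1 then biprod (C1 j) (C0 j.+1) else C0 0%N.

End Abelian.

Arguments exact_at A : clear implicits.

(* Main.v *)
Require Import Defs.
From mathcomp Require Import all_boot all_algebra.

Set Implicit Arguments.
Unset Strict Implicit.
Unset Printing Implicit Defensive.

Import GRing.Theory.
Local Open Scope ring_scope.

(** The sequence R is the mapping cone of a morphism of complexes R0 -> R1
    lifting g, in which the pair Y0 -> Y1 at the left end has been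
    replaced by the kernel Y of g.  The lift exists because R0 is exact after
    Hom(-, C) and the terms of R1 are in C (comparison_exists); it
    commutes with the differentials up to the truncation, and its later
    components are arbitrary.

    The differential of the cone in degree j has image the set of pairs
    (e w + al c, d c), where d is the differential of R0, al the lift of g, and
    e the map of R1 into its j-th term, which is Y1 -> C1 0 for j = 0.  This
    description (cone_diff_shape, cone_diff_hits) is the same in degree 0 and
    above, and the exactness and Ext statements all follow from it.

    - A cycle (x, y) of the cone has y = d c by exactness of R0, and then
      x - al c is a cycle of R1, hence of the form e w; so (x, y) is in the
      image above.  The chase is carried out on generalized elements T -> X up
      to a class of coverings T' -> T.  With all epimorphisms as coverings it
      proves exactness in the category; with maps out of D and split
      epimorphisms it proves exactness after Hom(D, -) (cone_lift_exact).

    - A map (w, z) that kills the image has w e = 0 and w al + z d = 0; it is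
      extended first on the R1 side and then on the R0 side (cone_hom_into).

    - The second projection maps the image onto the image of d, and its kernel
      is the image of e (pair_image_extension).  Hence Ext^1(-, D) vanishes on
      the images of the cone as soon as it does on those of R0 and of R1 and on
      Y1, vanishing being stable under extensions (Ext1_eq0_extension). *)

Local Notation "g \c f" := (compm g f) (at level 40, left associativity).

(** * Additive calculus *)

Section PreadditiveTheory.
Variable A : preadditive.
Implicit Types X Y Z T : A.

Lemma compm0 X Y Z (g : mor Y Z) : g \c (0 : mor X Y) = 0.
Proof. by apply: (addrI (g \c 0)); rewrite -compmDr !addr0. Qed.

Lemma comp0m X Y Z (f : mor X Y) : (0 : mor Y Z) \c f = 0.
Proof. by apply: (addrI (0 \c f)); rewrite -compmDl !addr0. Qed.

Lemma compmN X Y Z (g : mor Y Z) (f : mor X Y) : g \c (- f) = - (g \c f).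
Proof. by apply: (addrI (g \c f)); rewrite -compmDr !subrr compm0. Qed.

Lemma compNm X Y Z (g : mor Y Z) (f : mor X Y) : (- g) \c f = - (g \c f).
Proof. by apply: (addrI (g \c f)); rewrite -compmDl !subrr comp0m. Qed.

Lemma compmBr X Y Z (g : mor Y Z) (f f' : mor X Y) :
  g \c (f - f') = g \c f - g \c f'.
Proof. by rewrite compmDr compmN. Qed.

Lemma compmBl X Y Z (g g' : mor Y Z) (f : mor X Y) :
  (g - g') \c f = g \c f - g' \c f.
Proof. by rewrite compmDl compNm. Qed.

Lemma monomorphismP X Y (f : mor X Y) :
  monomorphism f <-> forall T (u : mor T X), f \c u = 0 -> u = 0.
Proof.
split=> [fm T u fu | fm T u v fuv].
  by apply: fm; rewrite fu compm0.
by apply/subr0_eq/fm; rewrite compmBr fuv subrr.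
Qed.

Lemma epimorphismP X Y (f : mor X Y) :
  epimorphism f <-> forall T (u : mor Y T), u \c f = 0 -> u = 0.
Proof.
split=> [fe T u fu | fe T u v fuv].
  by apply: fe; rewrite fu comp0m.
by apply/subr0_eq/fe; rewrite compmBl fuv subrr.
Qed.

Lemma mono_comp X Y Z (g : mor Y Z) (f : mor X Y) :
  monomorphism g -> monomorphism f -> monomorphism (g \c f).
Proof. by move=> gm fm T u v; rewrite -!compmA => /gm/fm. Qed.

Lemma epi_comp X Y Z (g : mor Y Z) (f : mor X Y) :
  epimorphism g -> epimorphism f -> epimorphism (g \c f).
Proof. by move=> ge fe T u v; rewrite !compmA => /fe/ge. Qed.

Lemma mono_cancel X Y Z (g : mor Y Z) (f : mor X Y) :
  monomorphism (g \c f) -> monomorphism f.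
Proof. by move=> gfm T u v fuv; apply: gfm; rewrite -!compmA fuv. Qed.

Lemma epi_cancel X Y Z (g : mor Y Z) (f : mor X Y) :
  epimorphism (g \c f) -> epimorphism g.
Proof. by move=> gfe T u v fuv; apply: gfe; rewrite !compmA fuv. Qed.

Lemma idmor_epi X : epimorphism (idmor X).
Proof. by move=> T u v; rewrite !compm1. Qed.

Lemma is_kernel_mono K X Y (f : mor X Y) (k : mor K X) :
  is_kernel f k -> monomorphism k.
Proof.
move=> [fk0 fk] T u v kuv.
have [|w [_ wu]] := fk _ (k \c u); first by rewrite compmA fk0 comp0m.
by rewrite -(wu u erefl) -(wu v (esym kuv)).
Qed.

Lemma is_cokernel_epi X Y K (f : mor X Y) (k : mor Y K) :
  is_cokernel f k -> epimorphism k.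
Proof.
move=> [fk0 fk] T u v kuv.
have [|w [_ wu]] := fk _ (u \c k); first by rewrite -compmA fk0 compm0.
by rewrite -(wu u erefl) -(wu v (esym kuv)).
Qed.

Lemma is_kernel_factor K X Y T (f : mor X Y) (k : mor K X) (h : mor T X) :
  is_kernel f k -> f \c h = 0 -> exists u, k \c u = h.
Proof. by move=> [_ fk] /fk[u [ku _]]; exists u. Qed.

Lemma is_cokernel_factor X Y K T (f : mor X Y) (k : mor Y K) (h : mor Y T) :
  is_cokernel f k -> h \c f = 0 -> exists u, u \c k = h.
Proof. by move=> [_ fk] /fk[u [ku _]]; exists u. Qed.

Lemma mono_is_kernelP K X Y (f : mor X Y) (k : mor K X) :
  monomorphism k -> f \c k = 0 ->
  (forall T (h : mor T X), f \c h = 0 -> exists u, k \c u = h) ->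
  is_kernel f k.
Proof.
move=> km fk0 fk; split=> // T h /fk[u ku]; exists u; split=> // v kv.
by apply: km; rewrite ku kv.
Qed.

End PreadditiveTheory.

(** * Biproducts and images in an abelian category *)

Section AbelianTheory.
Variable A : abelian.
Implicit Types X Y Z D T : A.

Definition pairm T X Y (u : mor T X) (v : mor T Y) : mor T (biprod X Y) :=
  injl X Y \c u + injr X Y \c v.

Definition copairm X Y T (u : mor X T) (v : mor Y T) : mor (biprod X Y) T :=
  u \c projl X Y + v \c projr X Y.

Lemma projl_pairm T X Y (u : mor T X) (v : mor T Y) :
  projl X Y \c pairm u v = u.
Proof.
have [li _ _ ri _] := biprodP X Y.
by rewrite compmDr !compmA li ri comp0m comp1m addr0.
Qed.

Lemma projr_pairm T X Y (u : mor T X) (v : mor T Y) :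
  projr X Y \c pairm u v = v.
Proof.
have [_ ri li _ _] := biprodP X Y.
by rewrite compmDr !compmA li ri comp0m comp1m add0r.
Qed.

Lemma pairm_eta T X Y (t : mor T (biprod X Y)) :
  pairm (projl X Y \c t) (projr X Y \c t) = t.
Proof.
have [_ _ _ _ id_sum] := biprodP X Y.
by rewrite /pairm !compmA -compmDl id_sum comp1m.
Qed.

Lemma copairm_injl X Y T (u : mor X T) (v : mor Y T) :
  copairm u v \c injl X Y = u.
Proof.
have [li _ ri _ _] := biprodP X Y.
by rewrite compmDl -!compmA li ri compm0 compm1 addr0.
Qed.

Lemma copairm_injr X Y T (u : mor X T) (v : mor Y T) :
  copairm u v \c injr X Y = v.
Proof.
have [_ ri _ li _] := biprodP X Y.
by rewrite compmDl -!compmA li ri compm0 compm1 add0r.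
Qed.

Lemma copairm_eta X Y T (t : mor (biprod X Y) T) :
  copairm (t \c injl X Y) (t \c injr X Y) = t.
Proof.
have [_ _ _ _ id_sum] := biprodP X Y.
by rewrite /copairm -!compmA -compmDr id_sum compm1.
Qed.

Lemma pairm_comp T' T X Y (u : mor T X) (v : mor T Y) (t : mor T' T) :
  pairm u v \c t = pairm (u \c t) (v \c t).
Proof. by rewrite /pairm compmDl -!compmA. Qed.

Lemma copairm_pairm T X Y Z (w : mor X Z) (z : mor Y Z) (u : mor T X)
    (v : mor T Y) :
  copairm w z \c pairm u v = w \c u + z \c v.
Proof. by rewrite {1}/pairm compmDr !compmA copairm_injl copairm_injr. Qed.

Lemma pairm0 T X Y : pairm (0 : mor T X) (0 : mor T Y) = 0.
Proof. by rewrite /pairm !compm0 addr0. Qed.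

Lemma pairm_inj T X Y (u u' : mor T X) (v v' : mor T Y) :
  pairm u v = pairm u' v' -> u = u' /\ v = v'.
Proof.
move=> e; split; first by rewrite -(projl_pairm u v) e projl_pairm.
by rewrite -(projr_pairm u v) e projr_pairm.
Qed.

Lemma kernel_mono X Y (f : mor X Y) : monomorphism (kernel_mor f).
Proof. exact: is_kernel_mono (kernelP f). Qed.

Lemma mono_factor X Y T (f : mor X Y) (h : mor T Y) :
  monomorphism f -> cokernel_mor f \c h = 0 -> exists u, f \c u = h.
Proof.
move=> /mono_is_kernel[Z [g fg]] ch0; apply: (is_kernel_factor fg).
have [v <-] := is_cokernel_factor (cokernelP f) fg.1.
by rewrite -compmA ch0 compm0.
Qed.

Lemma epi_factor X Y T (f : mor X Y) (h : mor X T) :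
  epimorphism f -> h \c kernel_mor f = 0 -> exists u, u \c f = h.
Proof.
move=> /epi_is_cokernel[Z [g fg]] ch0; apply: (is_cokernel_factor fg).
have [v <-] := is_kernel_factor (kernelP f) fg.1.
by rewrite compmA ch0 comp0m.
Qed.

(** Epimorphisms are stable under pullback: the pullback is the kernel of the
    epimorphism (f, -h) : X (+) Y -> Z, so a map out of Y that dies on it
    factors through (f, -h) by a map that dies on f. *)
Lemma epi_pullback X Y Z (f : mor X Z) (h : mor Y Z) :
  epimorphism f ->
  exists (P : A) (e : mor P Y) (x : mor P X),
    epimorphism e /\ f \c x = h \c e.
Proof.
move=> fe; pose q := copairm f (- h); pose k := kernel_mor q.
exists (kernel q), (projr X Y \c k), (projl X Y \c k); split; last first.
  apply/subr0_eq; rewrite -compNm -copairm_pairm pairm_eta.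
  exact: (kernelP q).1.
apply/epimorphismP => T u uk0.
have qe : epimorphism q.
  by apply: (@epi_cancel _ _ _ _ q (injl X Y)); rewrite copairm_injl.
have [v vq] : exists v, v \c q = u \c projr X Y.
  by apply: epi_factor => //; rewrite -compmA.
have v0 : v = 0.
  move/epimorphismP: fe; apply; rewrite -[f](copairm_injl f (- h)) compmA.
  by rewrite -/q vq -compmA; have [_ _ -> _ _] := biprodP X Y; rewrite compm0.
rewrite -[u]compm1; have [_ <- _ _ _] := biprodP X Y.
by rewrite compmA -vq v0 !comp0m.
Qed.

(** The corestriction of f to its image is an epimorphism: the kernel of a map
    that kills it is again a kernel, of a map that kills f, hence contains the
    image. *)
Lemma im_factor X Y (f : mor X Y) :
  exists e : mor X (im_obj f), epimorphism e /\ im_mor f \c e = f.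
Proof.
have [e fE] : exists e, im_mor f \c e = f.
  exact: is_kernel_factor (kernelP (cokernel_mor f)) (cokernelP f).1.
exists e; split=> //; apply/epimorphismP => T u ue0.
have imM : monomorphism (im_mor f) by exact: kernel_mono.
have [x xe] := is_kernel_factor (kernelP u) ue0.
have [Z [h hk]] := mono_is_kernel (mono_comp imM (@kernel_mono _ _ u)).
have hf0 : h \c f = 0.
  by rewrite -fE -xe (compmA (im_mor f)) (compmA h) hk.1 comp0m.
have [v vc] := is_cokernel_factor (cokernelP f) hf0.
have him0 : h \c im_mor f = 0.
  by rewrite -vc -compmA (kernelP (cokernel_mor f)).1 compm0.
have [s sE] := is_kernel_factor hk him0.
have ks : kernel_mor u \c s = idmor _.
  by apply: imM; rewrite compmA sE compm1.
by rewrite -[u]compm1 -ks compmA (kernelP u).1 comp0m.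
Qed.

(** * Exactness tested on generalized elements *)

(** The morphisms T -> X from tested objects T serve as elements of X, and
    lifting an element is only required after a covering.  Up to the vanishing
    of the composite, exactness in the category and exactness after Hom(D, -)
    both amount to such a lifting property, so that one element chase treats
    the two. *)
Record test_class := TestClass {
  tested : A -> Prop;
  covering : forall T' T, mor T' T -> Prop;
  covering_id : forall T, covering (idmor T);
  covering_comp : forall T'' T' T (e : mor T' T) (e' : mor T'' T'),
    covering e -> covering e' -> covering (e \c e');
  covering_epi : forall T' T (e : mor T' T), covering e -> epimorphism e
}.

Definition lifts (Th : test_class) T X Y (f : mor X Y) (h : mor T Y) :=
  exists (T' : A) (e : mor T' T) (x : mor T' X),
    [/\ tested Th T', covering Th e & f \c x = h \c e].

Definition lift_exact (Th : test_class) : exactness_notion A :=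
  fun X Y Z f g =>
  forall T (h : mor T Y), tested Th T -> g \c h = 0 -> lifts Th f h.

Definition epi_tests : test_class.
Proof.
apply: (@TestClass (fun=> True) (fun T' T e => epimorphism e)) => //.
- exact: idmor_epi.
- by move=> T'' T' T e e'; apply: epi_comp.
Defined.

Definition split_epi T' T (e : mor T' T) :=
  exists s : mor T T', e \c s = idmor T.

(** The only tested object is D; since its coverings are split, a lift after a
    covering gives a lift on D itself. *)
Definition hom_tests D : test_class.
Proof.
apply: (@TestClass (fun T => T = D) split_epi).
- by move=> T; exists (idmor T); rewrite compm1.
- move=> T'' T' T e e' [s es] [s' es']; exists (s' \c s).
  by rewrite compmA -(compmA e) es' compm1.
- move=> T' T e [s es]; apply/epimorphismP => X u ue0.
  by rewrite -[u]compm1 -es compmA ue0 comp0m.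
Defined.

Section Tests.
Variable Th : test_class.

Lemma lifts_exact T X Y (f : mor X Y) (x : mor T X) :
  tested Th T -> lifts Th f (f \c x).
Proof.
move=> Tt; exists T, (idmor T), x; split=> //; last by rewrite compm1.
exact: covering_id.
Qed.

Lemma lifts_cover T T' X Y (f : mor X Y) (h : mor T Y) (e : mor T' T) :
  covering Th e -> lifts Th f (h \c e) -> lifts Th f h.
Proof.
move=> ec [T'' [e' [x [T''t e'c fx]]]]; exists T'', (e \c e'), x; split=> //.
  exact: covering_comp.
by rewrite fx compmA.
Qed.

Lemma lift_exact0P X Y (f : mor X Y) :
  lift_exact Th (0 : mor (zob A) X) f <->
  forall T (u : mor T X), tested Th T -> f \c u = 0 -> u = 0.
Proof.
split=> fm T u Tt fu.
  have [T' [e [x [_ /covering_epi/epimorphismP ee]]]] := fm _ _ Tt fu.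
  by rewrite comp0m => /esym/ee.
rewrite (fm _ _ Tt fu) -(comp0m _ (0 : mor T (zob A))).
exact: lifts_exact.
Qed.

Lemma lift_exact_to0P X Y (g : mor X Y) :
  lift_exact Th g (0 : mor Y (zob A)) <->
  forall T (h : mor T Y), tested Th T -> lifts Th g h.
Proof.
split=> gs T h Tt; last by move=> _; apply: gs.
by apply: gs => //; rewrite comp0m.
Qed.

End Tests.

Lemma lifts_im T X Y (f : mor X Y) (h : mor T Y) :
  lifts epi_tests f h -> exists u, im_mor f \c u = h.
Proof.
move=> [T' [e [x [_ /epimorphismP ee fx]]]].
apply: (is_kernel_factor (kernelP _)); apply: ee.
by rewrite -compmA -fx compmA (cokernelP f).1 comp0m.
Qed.

(** That every element killed by g lifts to X locally says that Ker g lies in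
    Im f: lifts descend to the image along coverings because a morphism lies in
    Im f as soon as the cokernel of f kills it. *)
Lemma exact_atP X Y Z (f : mor X Y) (g : mor Y Z) :
  exact_at A _ _ _ f g <-> g \c f = 0 /\ lift_exact epi_tests f g.
Proof.
have [e [ee fE]] := im_factor f.
split=> [fg | [gf0 fg]].
  split; first by rewrite -fE compmA fg.1 comp0m.
  move=> T h _ gh0; have [u <-] := is_kernel_factor fg gh0.
  have [P [e' [x [e'e ex]]]] := epi_pullback u ee.
  by exists P, e', x; split=> //; rewrite -{1}fE -!compmA ex.
apply: mono_is_kernelP; first exact: kernel_mono.
  by move/epimorphismP: ee; apply; rewrite -compmA fE.
by move=> T h gh0; apply: lifts_im; apply: fg.
Qed.

Lemma exact_hom_from_lift D X Y Z (f : mor X Y) (g : mor Y Z) :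
  exact_hom_from D f g -> lift_exact (hom_tests D) f g.
Proof.
move=> fg T h TD; rewrite /= in TD; subst T => /fg[u <-].
exact: lifts_exact.
Qed.

Lemma lift_exact_hom_from D X Y Z (f : mor X Y) (g : mor Y Z) :
  g \c f = 0 -> lift_exact (hom_tests D) f g -> exact_hom_from D f g.
Proof.
move=> gf0 fg v; split=> [gv0 | [u <-]]; last first.
  by rewrite /hom_covar compmA gf0 comp0m.
have [T' [e [x [_ [s es] fx]]]] := fg _ v erefl gv0.
by exists (x \c s); rewrite /hom_covar compmA fx -compmA es compm1.
Qed.

Lemma exact_at0P X Y (f : mor X Y) :
  exact_at A _ _ _ (0 : mor (zob A) X) f <-> monomorphism f.
Proof.
split=> [/exact_atP[_ /lift_exact0P fm] | /monomorphismP fm].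
  by apply/monomorphismP => T u; apply: fm.
by apply/exact_atP; split; [rewrite compm0 | apply/lift_exact0P => T u _ /fm].
Qed.

Lemma exact_at_to0P X Y (g : mor X Y) :
  exact_at A _ _ _ g (0 : mor Y (zob A)) <-> epimorphism g.
Proof.
split=> [/exact_atP[_ /lift_exact_to0P ge] | ge].
  have [T [e [x [_ ee gx]]]] := ge _ (idmor Y) I.
  by apply: (@epi_cancel _ _ _ _ g x); rewrite gx comp1m.
apply/exact_atP; split; first by rewrite comp0m.
apply/lift_exact_to0P => T h _.
by have [P [e [x [ee gx]]]] := epi_pullback h ge; exists P, e, x.
Qed.

Lemma lift_exact_kernel X Y Z (a : mor X Y) (b : mor Y Z) :
  monomorphism a -> b \c a = 0 -> lift_exact epi_tests a b -> is_kernel b a.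
Proof.
move=> am ba0 ab; apply: mono_is_kernelP => // T h bh0.
apply: mono_factor => //.
have [T' [e [x [_ /epimorphismP ee ax]]]] := ab _ _ I bh0.
by apply: ee; rewrite -compmA -ax compmA (cokernelP a).1 comp0m.
Qed.

Lemma short_exactP X Y Z (a : mor X Y) (b : mor Y Z) :
  short_seq (exact_at A) a b <-> is_kernel b a /\ epimorphism b.
Proof.
split=> [[/exact_at0P am /exact_atP[ba0 ab] /exact_at_to0P be] | [ab be]].
  by split=> //; apply: lift_exact_kernel.
split; [| | exact/exact_at_to0P].
  exact/exact_at0P/(is_kernel_mono ab).
apply/exact_atP; split; first exact: ab.1.
by move=> T h _ /(is_kernel_factor ab)[u <-]; apply: lifts_exact.
Qed.

(** * Vanishing of Ext *)

(** Every map out of the kernel of an extension of K extends if and only if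
    every extension of K splits: push the extension out along the map and
    retract the result. *)
Lemma Ext1_eq0P K D :
  Ext1_eq0 K D <->
  forall X Z (a : mor X Z) (b : mor Z K), short_seq (exact_at A) a b ->
  forall u : mor X D, exists v : mor Z D, v \c a = u.
Proof.
split=> [ext X Z a b /short_exactP[ab be] u | ext E a b ab]; last first.
  have [r ra] := ext _ _ _ _ ab (idmor D).
  exists (pairm r b); rewrite projr_pairm; split=> //.
  have /short_exactP[[ba0 _] _] := ab.
  by rewrite pairm_comp ra ba0 /pairm compm0 compm1 addr0.
have am := is_kernel_mono ab.
(* The pushout of a and u is the cokernel of j = (u, -a), with structure maps
   d out of D and z out of Z. *)
pose j := pairm u (- a); pose q := cokernel_mor j.
have qj0 : q \c j = 0 := (cokernelP j).1.
have jm : monomorphism j.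
  apply: (@mono_cancel _ _ _ _ (projr D Z)); rewrite projr_pairm.
  by move=> T v w; rewrite !compNm => /oppr_inj/am.
pose d := q \c injl D Z; pose z := q \c injr D Z.
have qE : q = copairm d z by rewrite copairm_eta.
have duza : d \c u = z \c a.
  by apply/subr0_eq; rewrite -compmN -copairm_pairm -qE.
have [p pq] : exists p, p \c q = copairm 0 b.
  apply: (is_cokernel_factor (cokernelP j)).
  by rewrite copairm_pairm comp0m compmN ab.1 oppr0 addr0.
have dp : short_seq (exact_at A) d p.
  apply/short_exactP; split; last first.
    apply: (@epi_cancel _ _ _ _ p z).
    by rewrite compmA pq copairm_injr.
  apply: lift_exact_kernel.
  - apply/monomorphismP => T v; rewrite -compmA => /(mono_factor jm)[w jw].
    have : pairm (u \c w) ((- a) \c w) = pairm v 0.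
      by rewrite -pairm_comp -/j jw /pairm compm0 addr0.
    case/pairm_inj => <-; rewrite compNm => /eqP; rewrite oppr_eq0 => /eqP aw0.
    by have /monomorphismP/(_ _ _ aw0) -> := am; rewrite compm0.
  - by rewrite compmA pq copairm_injl.
  move=> T h _ ph0.
  have [T' [e [s [ee qs]]]] := epi_pullback h (is_cokernel_epi (cokernelP j)).
  have [y ay] : exists y, a \c y = projr D Z \c s.
    apply: (is_kernel_factor ab); rewrite -[RHS](comp0m _ e) -ph0 -compmA -qs.
    by rewrite -/q !compmA pq /copairm comp0m add0r.
  exists T', e, (projl D Z \c s + u \c y); split=> //.
  rewrite -qs -/q compmDr (compmA d u) duza -compmA ay.
  by rewrite -copairm_pairm pairm_eta -qE.
have [phi [phid _]] := ext _ _ _ dp.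
exists (projl D K \c phi \c z).
rewrite -compmA -duza compmA -(compmA _ phi d) phid.
by have [-> _ _ _ _] := biprodP D K; rewrite comp1m.
Qed.

(** Extend a map to the preimage of K' in the middle term, then to the whole
    middle term, whose quotient by that preimage is K''. *)
Lemma Ext1_eq0_extension K' K K'' D (i : mor K' K) (p : mor K K'') :
  short_seq (exact_at A) i p -> Ext1_eq0 K' D -> Ext1_eq0 K'' D ->
  Ext1_eq0 K D.
Proof.
move=> /short_exactP[ip pe] /Ext1_eq0P ext' /Ext1_eq0P ext''.
apply/Ext1_eq0P => X Z a b /short_exactP[ab be] u.
have im := is_kernel_mono ip; have am := is_kernel_mono ab.
have zpb := kernelP (p \c b); set z := kernel_mor _ in zpb.
have zm := is_kernel_mono zpb.
have [b' ib'] : exists b', i \c b' = b \c z.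
  by apply: (is_kernel_factor ip); rewrite compmA zpb.1.
have [a' za'] : exists a', z \c a' = a.
  by apply: (is_kernel_factor zpb); rewrite -compmA ab.1 compm0.
have ab' : short_seq (exact_at A) a' b'.
  apply/short_exactP; split.
    apply: mono_is_kernelP.
    - by apply: (@mono_cancel _ _ _ _ z); rewrite za'.
    - by apply: im; rewrite compmA ib' -compmA za' ab.1 compm0.
    move=> T h b'h0.
    have [|w aw] := is_kernel_factor (h := z \c h) ab.
      by rewrite compmA -ib' -compmA b'h0 compm0.
    by exists w; apply: zm; rewrite compmA za'.
  have [T [e [x [ee bx]]]] := epi_pullback i be.
  have [|x' zx'] := is_kernel_factor (h := x) zpb.
    by rewrite -compmA bx compmA ip.1 comp0m.
  apply: (@epi_cancel _ _ _ _ b' x').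
  suff -> : b' \c x' = e by [].
  by apply: im; rewrite compmA ib' -compmA zx'.
have [u' u'a'] := ext' _ _ _ _ ab' u.
have zpbS : short_seq (exact_at A) z (p \c b).
  by apply/short_exactP; split=> //; apply: epi_comp.
have [v vz] := ext'' _ _ _ _ zpbS u'.
by exists v; rewrite -za' compmA vz.
Qed.

(** * The image of a differential of the cone *)

(** The image of d consists of the pairs (e w + h c, a c), so that its second
    projection is the image of a, and the kernel of that projection is the image
    of e, because h c is e (h0 y) as soon as c = a0 y.  The image of e enters
    through any factorization e = m p into an epimorphism and a
    monomorphism. *)
Lemma pair_image_extension P W K' B1 A0 A1 A2 (a0 : mor A0 A1) (a : mor A1 A2)
    (e : mor W B1) (h0 : mor A0 W) (h : mor A1 B1) (d : mor P (biprod B1 A2))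
    (p : mor W K') (m : mor K' B1) :
  exact_at A _ _ _ a0 a -> h \c a0 = e \c h0 ->
  epimorphism p -> monomorphism m -> m \c p = e ->
  (forall T (t : mor T P), exists (w : mor T W) (c : mor T A1),
     d \c t = pairm (e \c w + h \c c) (a \c c)) ->
  (forall T (w : mor T W) (c : mor T A1),
     lifts epi_tests d (pairm (e \c w + h \c c) (a \c c))) ->
  exists (i : mor K' (im_obj d)) (s : mor (im_obj d) (im_obj a)),
    short_seq (exact_at A) i s.
Proof.
move=> /exact_atP[aa0 a0a] ha0 pe mm mp shape hits.
have [q [qe dE]] := im_factor d; have [q' [q'e aE]] := im_factor a.
have dm : monomorphism (im_mor d) by exact: kernel_mono.
have am : monomorphism (im_mor a) by exact: kernel_mono.
have [i iE] : exists i, im_mor d \c i = pairm m 0.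
  apply: lifts_im; apply: (lifts_cover (e := p)) => //.
  have := hits _ (idmor W) 0.
  by rewrite pairm_comp mp comp0m !compm0 compm1 addr0.
have [s sE] : exists s, im_mor a \c s = projr B1 A2 \c im_mor d.
  apply: lifts_im; apply: (lifts_cover (e := q)) => //.
  have [w [c]] := shape _ (idmor P).
  by rewrite -compmA dE compm1 => ->; rewrite projr_pairm; apply: lifts_exact.
exists i, s; apply/short_exactP; split.
  apply: lift_exact_kernel.
  - apply: (@mono_cancel _ _ _ _ (projl B1 A2 \c im_mor d)).
    by rewrite -compmA iE projl_pairm.
  - by apply: am; rewrite compmA sE -compmA iE projr_pairm compm0.
  move=> T t _ st0; have [T1 [e1 [x [e1e qx]]]] := epi_pullback t qe.
  have dx : d \c x = im_mor d \c t \c e1 by rewrite -{1}dE -!compmA qx.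
  have [w [c dxE]] := shape _ x.
  have ac0 : a \c c = 0.
    rewrite -(projr_pairm (e \c w + h \c c) (a \c c)) -dxE dx !compmA -sE.
    by rewrite -(compmA _ s t) st0 compm0 comp0m.
  have [T2 [e2 [y [_ e2e a0y]]]] := a0a _ c I ac0.
  exists T2, (e1 \c e2), (p \c (w \c e2 + h0 \c y)); split=> //.
    exact: epi_comp.
  apply: dm; rewrite !compmA iE -dx dxE !pairm_comp mp comp0m ac0 comp0m.
  by rewrite compmDl compmDr !compmA -ha0 -!compmA a0y comp0m.
have [T [e1 [x [_ e1e dx]]]] := hits _ 0 (idmor A1).
have sqx : s \c (q \c x) = q' \c e1.
  apply: am; rewrite !compmA sE aE -(compmA _ _ q) dE -compmA dx.
  by rewrite pairm_comp projr_pairm compm1.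
by apply: (@epi_cancel _ _ _ _ s (q \c x)); rewrite sqx; apply: epi_comp.
Qed.

(** * Truncated coresolutions *)

Definition prev_term M (Z : nat -> A) i : A := if i is j.+1 then Z j else M.

(** Treating the augmentation as one more differential makes exactness at all
    the terms but the last a single statement. *)
Definition incoming M (Z : nat -> A) (S : coseq M Z) i :
    mor (prev_term M Z i) (Z i) :=
  match i with 0 => caug S | j.+1 => cdiff S j end.

Lemma coseq_exactP ex m M (Z : nat -> A)
    (S : coseq M Z) :
  coseq_exact ex m S <->
  ex _ _ _ (0 : mor (zob A) M) (caug S) /\
  forall i, (i < m)%N -> ex _ _ _ (incoming S i) (cdiff S i).
Proof.
split=> [[ex0 ex1 exS] | [ex0 exS]].
  by split=> // -[|i] im; [apply: ex1 | apply: exS].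
by split=> // [m0 | i im]; [apply: (exS 0%N) | apply: (exS i.+1)].
Qed.

Lemma coseq_exact_impl2 (ex1 ex2 ex : exactness_notion A) m M
    (Z : nat -> A) (S : coseq M Z) :
  (forall X1 X2 X3 (a : mor X1 X2) (b : mor X2 X3),
     ex1 _ _ _ a b -> ex2 _ _ _ a b -> ex _ _ _ a b) ->
  coseq_exact ex1 m S -> coseq_exact ex2 m S -> coseq_exact ex m S.
Proof.
move=> ex12 /coseq_exactP[a1 b1] /coseq_exactP[a2 b2]; apply/coseq_exactP.
by split=> [|i im]; apply: ex12; auto.
Qed.

Lemma coseq_exact_impl (ex1 ex : exactness_notion A) m M
    (Z : nat -> A) (S : coseq M Z) :
  (forall X1 X2 X3 (a : mor X1 X2) (b : mor X2 X3),
     ex1 _ _ _ a b -> ex _ _ _ a b) ->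
  coseq_exact ex1 m S -> coseq_exact ex m S.
Proof. by move=> ex1ex S1; apply: (coseq_exact_impl2 _ S1 S1) => *; auto. Qed.

Lemma short_seq_impl (ex1 ex : exactness_notion A) X Y Z (f : mor X Y)
    (g : mor Y Z) :
  (forall X1 X2 X3 (a : mor X1 X2) (b : mor X2 X3),
     ex1 _ _ _ a b -> ex _ _ _ a b) ->
  short_seq ex1 f g -> short_seq ex f g.
Proof. by move=> ex1ex [? ? ?]; split; apply: ex1ex. Qed.

(** Together with lift_exact it makes up exactness; as an exactness notion, it
    can be carried along a sequence like the others. *)
Definition null_composite : exactness_notion A := fun X Y Z f g => g \c f = 0.

Lemma exact_at_null X Y Z (f : mor X Y) (g : mor Y Z) :
  exact_at A _ _ _ f g -> null_composite f g.
Proof. by case/exact_atP. Qed.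

Lemma exact_hom_into_extend D X Y Z (f : mor X Y) (g : mor Y Z) (u : mor Y D) :
  exact_hom_into D f g -> u \c f = 0 -> exists v, v \c g = u.
Proof. by move=> fg; apply: (fg u).1. Qed.

Lemma extend_exact_hom_into D X Y Z (f : mor X Y) (g : mor Y Z) :
  g \c f = 0 ->
  (forall u : mor Y D, u \c f = 0 -> exists v, v \c g = u) ->
  exact_hom_into D f g.
Proof.
move=> gf0 fg u; split=> [/fg // | [v <-]].
by rewrite /hom_contra -compmA gf0 compm0.
Qed.

(** * The mapping cone of a comparison morphism *)

Section Cone.
Variables (Y Y0 Y1 : A) (f : mor Y Y0) (g : mor Y0 Y1).
Variables (C0 : nat -> A) (R0 : coseq Y0 C0) (C1 : nat -> A) (R1 : coseq Y1 C1).

Definition prev_comparison (al : forall i, mor (C0 i) (C1 i)) i :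
    mor (prev_term Y0 C0 i) (prev_term Y1 C1 i) :=
  match i with 0 => g | j.+1 => al j end.

Definition comparison m (al : forall i, mor (C0 i) (C1 i)) :=
  forall i, (i <= m)%N ->
  al i \c incoming R0 i = incoming R1 i \c prev_comparison al i.

(** The lift of g is built degree by degree: what has been constructed kills
    the incoming differential of R0, hence extends along the outgoing one, as
    its target is a term of R1. *)
Lemma comparison_exists m n :
  (m < n)%N ->
  (forall i, (i <= m)%N -> coseq_exact (exact_hom_into (C1 i)) n R0) ->
  coseq_exact null_composite m R1 ->
  exists al, comparison m al.
Proof.
elim: m => [|m IH] mn intoR0 nullR1.
  have /coseq_exactP[R0_0 _] := intoR0 _ (leqnn 0).
  have [|u uE] := exact_hom_into_extend (u := caug R1 \c g) R0_0.
    by rewrite compm0.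
  exists (dfwith (fun i => 0 : mor (C0 i) (C1 i)) u) => -[|//] _ /=.
  by rewrite dfwith_in.
have /coseq_exactP[null0 nullS] := nullR1.
have [||al alP] := IH (ltnW mn); first by move=> i /leqW; apply: intoR0.
  by apply/coseq_exactP; split=> // i /leqW; apply: nullS.
have /coseq_exactP[_ R0_S] := intoR0 _ (leqnn m.+1).
have [|u uE] :=
    exact_hom_into_extend (u := cdiff R1 m \c al m) (R0_S m (ltnW mn)).
  by rewrite -compmA alP // compmA nullS // comp0m.
exists (dfwith al u) => i; rewrite leq_eqVlt => /predU1P[-> /= | im].
  by rewrite dfwith_in uE dfwith_out // gtn_eqF.
rewrite dfwith_out ?gtn_eqF //; case: i im => [|i] im; first exact: alP.
rewrite /= dfwith_out; last by rewrite gtn_eqF // ltnW.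
exact: (alP i.+1 im).
Qed.

Variable al : forall i, mor (C0 i) (C1 i).

Definition cone_diff i :
    mor (cone_terms C0 C1 i) (cone_terms C0 C1 i.+1) :=
  match i with
  | 0 => pairm (al 0) (cdiff R0 0)
  | j.+1 => pairm (al j.+1 \c projr (C1 j) (C0 j.+1)
                     - cdiff R1 j \c projl (C1 j) (C0 j.+1))
                  (cdiff R0 j.+1 \c projr (C1 j) (C0 j.+1))
  end.

Definition cone : coseq Y (cone_terms C0 C1) := Coseq (caug R0 \c f) cone_diff.

Lemma cone_diffS_pairm j T (x : mor T (C1 j)) (y : mor T (C0 j.+1)) :
  cone_diff j.+1 \c pairm x y =
  pairm (al j.+1 \c y - cdiff R1 j \c x) (cdiff R0 j.+1 \c y).
Proof.
by rewrite /= pairm_comp compmBl -!compmA projl_pairm projr_pairm.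
Qed.

(** In degree 0 the term of the cone is C0 0 alone rather than Y1 (+) C0 0;
    writing the image of every differential in this form, with the incoming
    map of R1, hides that difference. *)
Lemma cone_diff_shape j T (t : mor T (cone_terms C0 C1 j)) :
  exists (w : mor T (prev_term Y1 C1 j)) (c : mor T (C0 j)),
    cone_diff j \c t
    = pairm (incoming R1 j \c w + al j \c c) (cdiff R0 j \c c).
Proof.
case: j t => [|j] t.
  by exists 0, t; rewrite /= pairm_comp compm0 add0r.
exists (- (projl _ _ \c t)), (projr _ _ \c t).
by rewrite -{1}[t]pairm_eta cone_diffS_pairm /= compmN addrC.
Qed.

Section ConeExact.
Variable N : nat.
Hypothesis alP : comparison N al.
Hypothesis gf0 : g \c f = 0.
Hypothesis nullR0 : coseq_exact null_composite N.+1 R0.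
Hypothesis nullR1 : coseq_exact null_composite N R1.

Lemma comparison_diff j : (j < N)%N ->
  al j.+1 \c cdiff R0 j = cdiff R1 j \c al j.
Proof. by move=> jN; rewrite -(alP jN). Qed.

Lemma R0_null j : (j < N.+1)%N -> cdiff R0 j \c incoming R0 j = 0.
Proof. by move=> jN; have /coseq_exactP[_ ->] := nullR0. Qed.

Lemma R1_null j : (j < N)%N -> cdiff R1 j \c incoming R1 j = 0.
Proof. by move=> jN; have /coseq_exactP[_ ->] := nullR1. Qed.

(** The counterpart of the previous lemma.  In degree 0 an element w of Y1 is
    first lifted to y in Y0, and then c is corrected by the image of y. *)
Lemma cone_diff_hits Th j T (w : mor T (prev_term Y1 C1 j)) (c : mor T (C0 j)) :
  lift_exact Th g (0 : mor Y1 (zob A)) -> tested Th T ->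
  lifts Th (cone_diff j)
    (pairm (incoming R1 j \c w + al j \c c) (cdiff R0 j \c c)).
Proof.
move=> /lift_exact_to0P gs Tt; case: j w c => [|j] w c; last first.
  have := lifts_exact (cone_diff j.+1) (pairm (- w) c) Tt.
  by rewrite cone_diffS_pairm /= compmN opprK (addrC (_ \c c)).
have [T' [e [y [T't ec gy]]]] := gs _ w Tt.
apply: (lifts_cover ec).
have := lifts_exact (cone_diff 0) (caug R0 \c y + c \c e) T't.
have /= a0 := alP (leq0n N); have /= d0 := R0_null (ltn0Sn N).
rewrite /= !pairm_comp !compmDr !compmA a0 d0 comp0m add0r compmDl.
by rewrite -(compmA _ g y) gy !compmA.
Qed.

Lemma cone_null : coseq_exact null_composite N.+1 cone.
Proof.
apply/coseq_exactP; split=> [|[|j] jN]; rewrite /null_composite /=.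
- by rewrite compm0.
- have /= a0 := alP (leq0n N); have /= d0 := R0_null (ltn0Sn N).
  rewrite pairm_comp !compmA a0 d0 comp0m -(compmA _ g f) gf0 compm0.
  exact: pairm0.
rewrite ltnS in jN; rewrite -[cone_diff j]compm1.
have [w [c ->]] := cone_diff_shape (idmor (cone_terms C0 C1 j)).
rewrite -/(cone_diff j.+1) cone_diffS_pairm compmDr !compmA comparison_diff //.
have /= -> := R0_null (j := j.+1) jN; rewrite R1_null // !comp0m add0r subrr.
exact: pairm0.
Qed.

(** A cycle (x, y) of the cone is lifted on the R0 side first, y = d c; what
    remains of x is then a cycle of R1.  In degree 0 the injectivity of
    Y1 -> C1 0 turns a cycle of the cone into an element of the kernel of g. *)
Lemma cone_lift_exact Th :
  short_seq (lift_exact Th) f g ->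
  coseq_exact (lift_exact Th) N.+1 R0 -> coseq_exact (lift_exact Th) N R1 ->
  coseq_exact (lift_exact Th) N.+1 cone.
Proof.
move=> [/lift_exact0P fm fg gs] /coseq_exactP[/lift_exact0P R0m R0e].
move=> /coseq_exactP[/lift_exact0P R1m R1e]; apply/coseq_exactP; split.
  apply/lift_exact0P => T u Tt; rewrite /= -compmA.
  by move=> /(R0m _ _ Tt)/(fm _ _ Tt).
move=> [|j] jN T h Tt.
  rewrite /= pairm_comp -[X in _ = X -> _](pairm0 _ _ _) => /pairm_inj[ah0 dh0].
  have [T' [e [y [T't ec yh]]]] := R0e 0%N isT _ _ Tt dh0.
  have gy0 : g \c y = 0.
    apply: R1m => //; have /= a0 := alP (leq0n N).
    by rewrite compmA -a0 -compmA yh compmA ah0 comp0m.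
  apply: (lifts_cover ec); have [T2 [e2 [x [T2t e2c fx]]]] := fg _ _ T't gy0.
  exists T2, e2, x; split=> //=.
  by rewrite -compmA fx compmA yh.
rewrite ltnS in jN; rewrite /= in h *.
rewrite -[h]pairm_eta; move: (projl _ _ \c h) (projr _ _ \c h) => {h} x y.
rewrite -/(cone_diff j.+1) cone_diffS_pairm -(pairm0 _ _ _).
move=> /pairm_inj[/subr0_eq axy dy0].
have [T1 [e1 [c [T1t e1c dc]]]] := R0e j.+1 jN _ _ Tt dy0.
have dxc0 : cdiff R1 j \c (x \c e1 - al j \c c) = 0.
  rewrite compmBr !compmA -axy -comparison_diff // -!compmA.
  by rewrite /= in dc; rewrite dc subrr.
have [T2 [e2 [w [T2t e2c ew]]]] := R1e j jN _ _ T1t dxc0.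
apply: (lifts_cover (covering_comp e1c e2c)).
have := cone_diff_hits w (c \c e2) gs T2t.
by rewrite /= in dc; rewrite ew compmBl !compmA addrNK dc !pairm_comp.
Qed.

Lemma cone_exact :
  short_seq (exact_at A) f g ->
  coseq_exact (exact_at A) N.+1 R0 -> coseq_exact (exact_at A) N R1 ->
  coseq_exact (exact_at A) N.+1 cone.
Proof.
have lift X1 X2 X3 (a : mor X1 X2) (b : mor X2 X3) :
  exact_at A _ _ _ a b -> lift_exact epi_tests a b by case/exact_atP.
move=> /(short_seq_impl lift) fg /(coseq_exact_impl lift) S0.
move=> /(coseq_exact_impl lift) S1.
apply: coseq_exact_impl2 cone_null (cone_lift_exact fg S0 S1) => *.
exact/exact_atP.
Qed.

Lemma cone_hom_from D :
  short_seq (exact_hom_from D) f g ->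
  coseq_exact (exact_hom_from D) N.+1 R0 ->
  coseq_exact (exact_hom_from D) N R1 ->
  coseq_exact (exact_hom_from D) N.+1 cone.
Proof.
have lift := @exact_hom_from_lift D.
move=> /(short_seq_impl lift) fg /(coseq_exact_impl lift) S0.
move=> /(coseq_exact_impl lift) S1.
apply: coseq_exact_impl2 cone_null (cone_lift_exact fg S0 S1) => *.
exact: lift_exact_hom_from.
Qed.

(** The chase dual to the one on generalized elements.  A map killing the
    image of a differential kills the two families of which that image
    consists; in degree 0 this uses that maps out of Y1 are detected on Y0. *)
Lemma cone_hom_into D :
  short_seq (exact_hom_into D) f g ->
  coseq_exact (exact_hom_into D) N.+1 R0 ->
  coseq_exact (exact_hom_into D) N R1 ->
  coseq_exact (exact_hom_into D) N.+1 cone.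
Proof.
move=> [fE fgE gE] /coseq_exactP[R0a R0e] /coseq_exactP[R1a R1e].
have g_epi (u : mor Y1 D) : u \c g = 0 -> u = 0.
  by move=> /(exact_hom_into_extend gE)[v <-]; rewrite compm0.
have /coseq_exactP[null0 nullS] := cone_null.
apply/coseq_exactP; split=> [|i iN]; apply: extend_exact_hom_into => //.
- move=> u _; have [|v vf] := exact_hom_into_extend (u := u) fE.
    by rewrite compm0.
  have [|w wR] := exact_hom_into_extend (u := v) R0a; first by rewrite compm0.
  by exists w; rewrite /= compmA wR.
- exact: nullS.
case: i iN => [|j] jN u u0.
  have /= a0 := alP (leq0n N).
  have [|v vg] := exact_hom_into_extend (u := u \c caug R0) fgE.
    by rewrite -compmA.
  have [|w wR] := exact_hom_into_extend (u := v) R1a; first by rewrite compm0.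
  have [|z zd] := exact_hom_into_extend (u := u - w \c al 0) (R0e 0%N isT).
    by rewrite /= compmBl -vg -wR -!compmA a0 subrr.
  by exists (copairm w z); rewrite /= copairm_pairm zd addrC subrK.
rewrite ltnS in jN; rewrite /= in u u0 *.
rewrite -[u]copairm_eta in u0 *.
move: (u \c injl _ _) (u \c injr _ _) u0 => {u} w z u0.
have [we0 waz0] : w \c incoming R1 j = 0 /\ w \c al j + z \c cdiff R0 j = 0.
  case: (j) (alP (ltnW jN)) w z u0 => [|k] /= ak w z.
    rewrite copairm_pairm => wz0; split=> //; apply: g_epi.
    rewrite -compmA -ak compmA (canRL (addrK _) wz0) sub0r compNm -compmA.
    by have /= -> := R0_null (ltn0Sn N); rewrite compm0 oppr0.
  rewrite copairm_pairm => wz0.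
  have := congr1 (fun t => t \c injl (C1 k) (C0 k.+1)) wz0.
  have := congr1 (fun t => t \c injr (C1 k) (C0 k.+1)) wz0.
  have [li ri rl lr _] := biprodP (C1 k) (C0 k.+1).
  rewrite !comp0m !compmDl !compmBr !compmBl -!compmA li ri rl lr.
  rewrite !compm0 !compm1 !subr0 sub0r addr0 => wa /eqP.
  by rewrite oppr_eq0 => /eqP.
have [w' w'E] := exact_hom_into_extend (R1e j jN) we0.
have [|z' z'E] := exact_hom_into_extend (u := z + w' \c al j.+1) (R0e j.+1 jN).
  rewrite /= compmDl -compmA comparison_diff // compmA w'E.
  by rewrite addrC waz0.
exists (copairm (- w') z'); rewrite copairm_pairm.
rewrite compmA z'E compmDl -compmA compNm compmBr !compmA w'E.
by rewrite opprB (addrC (z \c _)) addrA subrK.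
Qed.

(** The image of each differential of the cone is an extension of an image of
    R0 by an image of R1, the latter being Y1 in degree 0. *)
Lemma cone_image_Ext1 D j :
  exact_at A _ _ _ (incoming R0 j) (cdiff R0 j) ->
  monomorphism (caug R1) -> epimorphism g -> (j <= N)%N ->
  Ext1_eq0 Y1 D -> (forall i, (i < N)%N -> Ext1_eq0 (im_obj (cdiff R1 i)) D) ->
  Ext1_eq0 (im_obj (cdiff R0 j)) D ->
  Ext1_eq0 (im_obj (cdiff cone j)) D.
Proof.
move=> R0e R1m ge jN Y1D R1D R0D.
have gs : lift_exact epi_tests g (0 : mor Y1 (zob A)).
  by have /exact_at_to0P/exact_atP[] := ge.
have [K' [p [m [pe mm mp K'D]]]] : exists (K' : A)
    (p : mor (prev_term Y1 C1 j) K') (m : mor K' (C1 j)),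
    [/\ epimorphism p, monomorphism m, m \c p = incoming R1 j & Ext1_eq0 K' D].
  case: j jN {R0e R0D} => [|j] jN.
    exists Y1, (idmor Y1), (caug R1); split=> //; last exact: compm1.
    exact: idmor_epi.
  have [q [qe qE]] := im_factor (cdiff R1 j).
  exists (im_obj (cdiff R1 j)), q, (im_mor (cdiff R1 j)); split=> //.
    exact: kernel_mono.
  exact: R1D.
have [i [s isE]] := pair_image_extension R0e (alP jN) pe mm mp
  (@cone_diff_shape j) (fun T w c => cone_diff_hits w c gs I).
exact: Ext1_eq0_extension isE K'D R0D.
Qed.

End ConeExact.
End Cone.

(** * The coresolution of Y *)

Lemma biprod_closed (C : A -> Prop) X Y :
  finite_sum_closed C -> C X -> C Y -> C (biprod X Y).
Proof.
move=> Csum CX CY.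
(* A family indexed by 'I_2; its injections and projections are typed by
   matching on the test that selects the summand. *)
pose F (k : 'I_2) : A := if k == 0 :> nat then X else Y.
apply: (Csum 1%N F); first by move=> k; rewrite /F; case: ifP.
have [ll rr rl lr id_sum] := biprodP X Y.
exists (fun k => match (k == 0 :> nat) as b return
          mor (if b then X else Y) (biprod X Y) with
        | true => injl X Y | false => injr X Y end).
exists (fun k => match (k == 0 :> nat) as b return
          mor (biprod X Y) (if b then X else Y) with
        | true => projl X Y | false => projr X Y end).
split=> [k | j k jk |].
- by rewrite /F; case: eqP.
- by rewrite /F; case: j k jk => [[|[|//]] ?] [[|[|//]] ?].
by rewrite !big_ord_recl big_ord0 /= addr0.
Qed.

End AbelianTheory.

Theorem theorem3p8 (A : abelian) (C : A -> Prop) (hC : iso_closed C)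
  (n : nat) (hn : (1 <= n)%N)
  (Y Y0 Y1 : A) (f : mor Y Y0) (g : mor Y0 Y1)
  (hE : short_seq (exact_at A) f g)
  (C0 : nat -> A) (R0 : coseq Y0 C0)
  (hR0 : coseq_exact (exact_at A) n R0) (hR0C : coseq_exact_into C n R0)
  (C1 : nat -> A) (R1 : coseq Y1 C1) (hR1 : coresolution C n.-1 R1) :
  exists R : coseq Y (cone_terms C0 C1),
    [/\ coseq_exact (exact_at A) n R,
        short_exact_from C f g -> coseq_exact_from C n R0 ->
          coseq_exact_from C n.-1 R1 -> coseq_exact_from C n R
      & finite_sum_closed C ->
        [/\ coresolution C n R0 -> coresolution C n R,
            short_exact_into C f g -> coproper_coresolution C n R0 ->
              coproper_coresolution C n.-1 R1 -> coproper_coresolution C n R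
          & short_exact_strongly_into C f g ->
              strongly_coproper_coresolution C n R0 ->
              strongly_coproper_coresolution C n.-1 R1 ->
              strongly_coproper_coresolution C n R]].
Proof.
case: n hn hR0 hR0C hR1 => [//|N] _ R0e R0C [/= R1e R1C].
have [fe fge ge] := hE; have gf0 : g \c f = 0 := exact_at_null fge.
have nullR0 := coseq_exact_impl (@exact_at_null A) R0e.
have nullR1 := coseq_exact_impl (@exact_at_null A) R1e.
have [al alP] : exists al, comparison g R0 R1 N al.
  by apply: (comparison_exists g (ltnSn N)) => // i iN; apply/R0C/R1C.
have Re := cone_exact alP gf0 nullR0 nullR1 hE R0e R1e.
exists (cone f R0 R1 al); split=> // [fgC R0f R1f D CD | Csum].
  exact: (cone_hom_from alP gf0 nullR0 nullR1 (fgC D CD) (R0f D CD) (R1f D CD)).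
have RC : coresolution C N.+1 R0 -> coresolution C N.+1 (cone f R0 R1 al).
  move=> [_ C0C]; split=> // -[|i] iN; first exact: C0C.
  by apply: biprod_closed => //; [apply: R1C | apply: C0C].
split=> // [fgC [/RC RCn R0i] [_ R1i] | [_ Y1D] [/RC RCn [_ R0s]] [_ [_ R1s]]].
  split=> // D CD.
  exact: (cone_hom_into alP gf0 nullR0 nullR1 (fgC D CD) (R0i D CD) (R1i D CD)).
split=> //; split=> // D CD i iN.
have /coseq_exactP[/exact_at0P R1m _] := R1e.
have /coseq_exactP[_ R0ex] := R0e.
apply: (cone_image_Ext1 alP) => //; auto.
exact/exact_at_to0P.
Qed.
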